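(* Let $E$ be a pseudo effect algebra satisfying (RDP)$_1$ and let $s$ be a state on $E$. Then there is a unique maximal regular Borel probability measure $\mu_s\sim\delta_s$ on $\mathcal B(\mathcal S(E))$ such that $$s(a)=\int_{\mathcal S(E)}\hat a(x)\,\mathrm d\mu_s(x),\qquad a\in E.$$
   Context: A pseudo effect algebra is a partial algebra $(E;+,0,1)$, with $+$ a partial binary operation and $0,1$ constants, such that for all $a,b,c\in E$: (i) $a+b$ and $(a+b)+c$ exist iff $b+c$ and $a+(b+c)$ exist, and then $(a+b)+c=a+(b+c)$; (ii) there are exactly one $d\in E$ and exactly one $e\in E$ with $a+d=e+a=1$; (iii) if $a+b$ exists, there are $d,e\in E$ with $a+b=d+a=b+e$; (iv) if $1+a$ or $a+1$ exists, then $a=0$. The order is $a\le b$ iff there is $c\in E$ with $a+c=b$. For $a,b\in E$, $a\ \mathbf{com}\ b$ means that for all $a_1\le a$ and $b_1\le b$ in $E$, $a_1$ and $b_1$ commute. (RDP)$_1$: for all $a_1,a_2,b_1,b_2\in E$ with $a_1+a_2=b_1+b_2$ there are $d_1,d_2,d_3,d_4\in E$ with $d_1+d_2=a_1$, $d_3+d_4=a_2$, $d_1+d_3=b_1$, $d_2+d_4=b_2$ and $d_2\ \mathbf{com}\ d_3$. A state on $E$ is a map $s:E\to[0,1]$ with $s(a+b)=s(a)+s(b)$ whenever $a+b$ is defined and $s(1)=1$. $\mathcal S(E)$ is the set of all states, a compact convex Hausdorff space under pointwise (weak) convergence. For $a\in E$, $\hat a:\mathcal S(E)\to[0,1]$ is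 $\hat a(x)=x(a)$. For a compact convex subset $K$ of a locally convex Hausdorff space: $\mathcal B(K)$ is the Borel $\sigma$-algebra; a Borel measure $\mu$ is regular if $\inf\{\mu(O): Y\subseteq O,\ O\text{ open}\}=\mu(Y)=\sup\{\mu(C): C\subseteq Y,\ C\text{ closed}\}$ for all $Y\in\mathcal B(K)$; $\delta_x$ is the Dirac measure at $x$; $\mathrm{Aff}(K)$ is the set of continuous affine functions $K\to\mathbb R$. $\mu\sim\lambda$ means $\int_K f\,\mathrm d\mu=\int_K f\,\mathrm d\lambda$ for all $f\in\mathrm{Aff}(K)$. The Choquet ordering is $\mu\prec\lambda$ iff $\int_K f\,\mathrm d\mu\le\int_K f\,\mathrm d\lambda$ for all continuous convex $f:K\to\mathbb R$. A regular Borel probability measure is maximal if it is maximal for $\prec$ among regular Borel probability measures on $K$. *)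

(* Defs.v *)
From HB Require Import structures.
From mathcomp Require Import all_boot all_order all_algebra.
From mathcomp Require Import all_classical all_reals all_analysis.
Set Implicit Arguments.
Unset Strict Implicit.
Unset Printing Implicit Defensive.
Import Order.TTheory GRing.Theory Num.Theory.
Import numFieldNormedType.Exports.
Local Open Scope classical_set_scope.
Local Open Scope ring_scope.

(* The partial operation is an option-valued function: [a + b] exists and
   equals [c] iff [pea_add a b = Some c].  An equation between option values is
   thus a Kleene equality: one side exists iff the other does, and then they
   agree. *)
Record pseudoEffectAlgebra := PseudoEffectAlgebra {
  pea_sort :> Type;
  pea_add : pea_sort -> pea_sort -> option pea_sort;
  pea_zero : pea_sort;
  pea_one : pea_sort;
  pea_addA : forall a b c : pea_sort,
    obind (fun ab => pea_add ab c) (pea_add a b) =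
    obind (fun bc => pea_add a bc) (pea_add b c);
  pea_compl : forall a : pea_sort,
    (exists! d, pea_add a d = Some pea_one) /\
    (exists! e, pea_add e a = Some pea_one);
  pea_conj : forall a b c : pea_sort, pea_add a b = Some c ->
    exists d e, pea_add d a = Some c /\ pea_add b e = Some c;
  pea_one_add : forall a : pea_sort,
    pea_add pea_one a <> None \/ pea_add a pea_one <> None -> a = pea_zero
}.

Section PseudoEffectAlgebraTheory.
Variable E : pseudoEffectAlgebra.
Implicit Types a b c d : E.

Definition pea_le a b : Prop := exists c, pea_add a c = Some b.

Definition pea_commute a b : Prop := pea_add a b = pea_add b a.

Definition pea_com a b : Prop :=
  forall a1 b1, pea_le a1 a -> pea_le b1 b -> pea_commute a1 b1.

Definition RDP1 : Prop :=
  forall a1 a2 b1 b2 c, pea_add a1 a2 = Some c -> pea_add b1 b2 = Some c ->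
  exists d1 d2 d3 d4,
    [/\ pea_add d1 d2 = Some a1, pea_add d3 d4 = Some a2,
        pea_add d1 d3 = Some b1, pea_add d2 d4 = Some b2 & pea_com d2 d3].

End PseudoEffectAlgebraTheory.

Arguments RDP1 : clear implicits.

HB.instance Definition _ (I : Type) (R : realType) :=
  GRing.Lmodule.copy {ptws I -> R^o} (I -> R^o).

(* A measurable type must be pointed, so the measure theory below is done on a
   subset [K] (with the topology induced by [V]) together with a point [x0] of
   [K].  Which point is chosen is immaterial: neither the topology nor the Borel
   sets depend on it. *)
Definition pointed_subset (V : topologicalType) (K : set V) (x0 : K) : Type :=
  set_type K.

HB.instance Definition _ (V : topologicalType) (K : set V) (x0 : K) :=
  Topological.copy (pointed_subset x0) (set_type K).
HB.instance Definition _ (V : topologicalType) (K : set V) (x0 : K) :=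
  isPointed.Build (pointed_subset x0) x0.

Definition borel (V : topologicalType) (K : set V) (x0 : K) :=
  g_sigma_algebraType (@open (pointed_subset x0)).

(* Intended for [K] compact and convex, [V] locally convex and Hausdorff; the
   definitions themselves need only the topology and linear structure of [V]. *)
Section Choquet.
Variables (R : realType) (V : preTopologicalLmodType R).
Variables (K : set V) (x0 : K).
Local Open Scope ereal_scope.
Implicit Types (mu lambda : probability (borel x0) R) (f : K -> R).

(* A library measure is a function on all subsets, with junk values off the
   sigma-algebra, so measures are compared on Borel sets only. *)
Definition same_measure mu lambda : Prop :=
  forall Y : set (borel x0), measurable Y -> mu Y = lambda Y.

Definition regular_measure mu : Prop :=
  forall Y : set (borel x0), measurable Y ->
    ereal_inf [set mu O | O in [set O : set K | open O /\ Y `<=` O]] = mu Y /\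
    mu Y = ereal_sup [set mu C | C in [set C : set K | closed C /\ C `<=` Y]].

(* [K] carries no linear structure of its own; for convex [K], a convex
   combination of [x] and [y] is the [z] in [K] equal to it in [V]. *)
Definition affine_on f : Prop :=
  forall (x y z : K) (t : R), (0 <= t <= 1)%R ->
    \val z = (t *: \val x + (1 - t) *: \val y)%R ->
    f z = (t * f x + (1 - t) * f y)%R.

Definition convex_on f : Prop :=
  forall (x y z : K) (t : R), (0 <= t <= 1)%R ->
    \val z = (t *: \val x + (1 - t) *: \val y)%R ->
    (f z <= t * f x + (1 - t) * f y)%R.

Definition measure_equiv mu lambda : Prop :=
  forall f, continuous f -> affine_on f ->
    \int[mu]_x (f x)%:E = \int[lambda]_x (f x)%:E.

Definition choquet_le mu lambda : Prop :=
  forall f, continuous f -> convex_on f ->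
    \int[mu]_x (f x)%:E <= \int[lambda]_x (f x)%:E.

Definition maximal_measure mu : Prop :=
  regular_measure mu /\
  forall lambda, regular_measure lambda -> choquet_le mu lambda ->
    same_measure lambda mu.

End Choquet.

Section States.
Variables (R : realType) (E : pseudoEffectAlgebra).

Definition is_state (s : E -> R) : Prop :=
  [/\ forall a, 0 <= s a <= 1,
      forall a b c, pea_add a b = Some c -> s c = s a + s b
    & s (pea_one E) = 1].

(* [states] is given the topology induced by the product topology on [E -> R],
   that is, pointwise convergence. *)
Definition states : set {ptws E -> R^o} := [set s | is_state s].

Definition hat (a : E) (x : states) : R := (\val x : E -> R) a.

End States.

Arguments states : clear implicits.

(* Main.v *)
Require Import Defs.
From HB Require Import structures.
From mathcomp Require Import all_boot all_order all_algebra.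
From mathcomp Require Import all_classical all_reals all_analysis.
From mathcomp Require Import measurable_realfun.
From mathcomp Require Import lra.
Set Implicit Arguments.
Unset Strict Implicit.
Unset Printing Implicit Defensive.
Import Order.TTheory GRing.Theory Num.Theory.
Import numFieldNormedType.Exports.
Local Open Scope classical_set_scope.
Local Open Scope ring_scope.

(** The state space K of E is a compact convex subset of a power of the real
    line, and (RDP)_1 makes it a simplex: the cone of positive additive
    functionals on E is a lattice, the meet of m and n being a |-> inf (m a1
    + n a2) over the decompositions a = a1 + a2 ([meet_positive_additive]).
    Hence two finite decompositions of the same functional have a common
    refinement ([functional_refinement], [common_refinement]).

    A finite decomposition s = m_1 + ... + m_n into positive functionals is
    the same thing as a finitely supported probability on K with barycenter
    s: it puts the mass m_i(1) at the state m_i / m_i(1). Integrating a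
    convex function against it can only increase under refinement
    ([homogenize_subadditive]), and refinement is directed, so these
    discrete measures form a net that increases for the Choquet order. An
    ultrafilter finer than this net yields a positive normalized linear
    functional I on all bounded functions, with I f at least the integral of
    f against every decomposition of s when f is convex ([exists_mean]). The
    values of I on continuous functions are the integrals of a regular Borel
    probability mu ([mean_representation], a form of the Riesz-Markov
    theorem).

    Conversely, let nu be a probability on K whose barycenter is s. Cutting
    K into small Borel pieces, and replacing nu on each of them by its mass
    at its barycenter, gives a decomposition of s whose integral of a
    continuous f is within epsilon of the integral of f against nu
    ([discretization]). So nu precedes mu: mu is the greatest probability
    representing s ([exists_greatest_measure]).

    The theorem follows. A regular measure above mu again represents s,
    hence is also below mu, and two regular measures with the same integrals
    of continuous convex functions coincide, since differences of such
    functions separate closed sets from the complements of their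
    neighbourhoods ([dc_separated_closed], [regular_determined]). A maximal
    measure that represents s is below mu, hence equal to it. *)

(** * Refinement in commutative monoids *)

Section Refinement.
Variables (R : realType) (M : nmodType).
Implicit Types L : seq M.

Definition subadditive (F : M -> R) :=
  F 0 = 0 /\ forall m n, F (m + n) <= F m + F n.

(** Refinement of finite families, recorded by its only consequence that
    matters for integrals of convex functions: passing to the parts increases
    the sums of subadditive functions. This takes the place of a map that
    assigns to each part the member to which it belongs. *)
Definition finer (L' L : seq M) := forall F : M -> R, subadditive F ->
  \sum_(m <- L) F m <= \sum_(m <- L') F m.

Definition refinement_property := forall m1 m2 n1 n2 : M, m1 + m2 = n1 + n2 ->
  exists a b c d, [/\ a + b = m1, c + d = m2, a + c = n1 & b + d = n2].

Lemma finer_refl L : finer L L.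
Proof. by move=> F _. Qed.

Lemma finer_trans L1 L2 L3 : finer L1 L2 -> finer L2 L3 -> finer L1 L3.
Proof. by move=> f12 f23 F sF; exact: le_trans (f23 F sF) (f12 F sF). Qed.

Lemma subadditive_sum F L : subadditive F ->
  F (\sum_(m <- L) m) <= \sum_(m <- L) F m.
Proof.
move=> [F0 FD]; elim: L => [|x L IH]; first by rewrite !big_nil F0.
by rewrite !big_cons (le_trans (FD _ _))// lerD2l.
Qed.

Hypothesis refM : refinement_property.

(** Riesz decomposition: a summand of a sum is a sum of summands of its
    terms. Induction on L, the head being split by the refinement property. *)
Lemma split_finer m n L : m + n = \sum_(x <- L) x ->
  exists P Q, [/\ \sum_(x <- P) x = m, \sum_(x <- Q) x = n & finer (P ++ Q) L].
Proof.
elim: L m n => [|x L IH] m n; rewrite ?big_nil ?big_cons => mn.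
  exists [:: m], [:: n]; rewrite !big_seq1; split=> // F [F0 FD].
  by rewrite big_nil !big_cons big_nil addr0 -F0 -mn.
have [a [b [c [d [<- <- acx bdL]]]]] := refM mn.
have [P [Q [Pb Qd fPQ]]] := IH _ _ bdL.
exists (a :: P), (c :: Q); rewrite !big_cons Pb Qd; split=> // F sF.
rewrite big_cons big_cat !big_cons/= addrACA.
by rewrite lerD ?(le_trans (fPQ _ sF)) ?big_cat// -acx; case: sF.
Qed.

(** The first member of L1 is a summand of the total of L2, so L2 refines to
    a part P with that total and a remainder Q, and the induction applies to the
    rest of L1 and Q. *)
Lemma common_refinement L1 L2 : \sum_(m <- L1) m = \sum_(m <- L2) m ->
  exists L, [/\ \sum_(m <- L) m = \sum_(m <- L1) m, finer L L1 & finer L L2].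
Proof.
elim: L1 L2 => [|m L1 IH] L2 L12.
  exists L2; split=> [//||]; last exact: finer_refl.
  move=> F sF; have := subadditive_sum L2 sF.
  by rewrite -L12 !big_nil; case: sF => ->.
move: L12; rewrite big_cons => /split_finer[P [Q [Pm QL1 fPQ]]].
have [L [LL1 fLL1 fLQ]] := IH Q (esym QL1).
exists (P ++ L); rewrite big_cat/= Pm LL1; split=> // F sF.
  by rewrite big_cons big_cat lerD ?fLL1// -Pm; exact: subadditive_sum.
by rewrite (le_trans (fPQ _ sF))// !big_cat lerD2l fLQ.
Qed.

End Refinement.

(** * Positive additive functionals on a pseudo effect algebra *)

Section Functionals.
Variables (R : realType) (E : pseudoEffectAlgebra).
Implicit Types a b c d : E.

(** If 1 + z = 1 then z = 0; writing e + a = 1, both a and a + 0 complement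
    e on the right. *)
Lemma pea_adda0 a : pea_add a (pea_zero E) = Some a.
Proof.
have [_ [e [ea1 _]]] := pea_compl a.
have [[d [ed1 ud]] _] := pea_compl e.
have [[z [z1 _]] _] := pea_compl (pea_one E).
have z0 : z = pea_zero E by apply: pea_one_add; left; rewrite z1.
have := pea_addA e a (pea_zero E).
rewrite ea1 /= -z0 z1; case: (pea_add a z) => //= b eb1.
by rewrite -(ud _ ea1) -(ud _ (esym eb1)).
Qed.

Lemma pea_add0a a : pea_add (pea_zero E) a = Some a.
Proof.
have [[d [ad1 _]] _] := pea_compl a.
have [_ [e [ed1 ue]]] := pea_compl d.
have [_ [z [z1 _]]] := pea_compl (pea_one E).
have z0 : z = pea_zero E by apply: pea_one_add; right; rewrite z1.
have := pea_addA (pea_zero E) a d.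
rewrite ad1 /= -z0 z1; case: (pea_add z a) => //= b bd1.
by rewrite -(ue _ ad1) -(ue _ bd1).
Qed.

Definition positive_additive (m : E -> R) :=
  (forall a, 0 <= m a) /\
  (forall a b c, pea_add a b = Some c -> m c = m a + m b).

(** The positive multiples of states, with 0. Bundling them makes the cone
    an additive monoid, to which the refinement lemmas apply. *)
Record functional := Functional {
  functional_fun :> E -> R;
  functionalP : positive_additive functional_fun }.

Implicit Types m n : functional.

Lemma functional_ge0 m a : 0 <= m a.
Proof. by case: m => ? []. Qed.

Lemma functional_add m a b c : pea_add a b = Some c -> m c = m a + m b.
Proof. by case: m => ? []; eauto. Qed.

Lemma functional_zero m : m (pea_zero E) = 0.
Proof.
apply: (addrI (m (pea_zero E))).
by rewrite addr0 -(functional_add m (pea_adda0 _)).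
Qed.

Lemma functional_le_one m a : m a <= m (pea_one E).
Proof.
have [[d [ad1 _]] _] := pea_compl a.
by rewrite (functional_add m ad1) lerDl functional_ge0.
Qed.

Lemma functional_ext m n : m =1 n -> m = n.
Proof.
case: m n => [m mP] [n nP] /= /funext mn; subst n.
by congr Functional; exact: Prop_irrelevance.
Qed.

Lemma positive_additive0 : positive_additive (fun=> 0).
Proof. by split=> // *; rewrite addr0. Qed.

Lemma positive_additiveD m n : positive_additive (fun a => m a + n a).
Proof.
split=> [a|a b c abc]; first by rewrite addr_ge0// functional_ge0.
by rewrite !(functional_add _ abc) addrACA.
Qed.

Definition functional_zeroM := Functional positive_additive0.
Definition functional_addM m n := Functional (positive_additiveD m n).

Lemma functional_addMA : associative functional_addM.
Proof. by move=> m n p; apply: functional_ext => a /=; rewrite addrA. Qed.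

Lemma functional_addMC : commutative functional_addM.
Proof. by move=> m n; apply: functional_ext => a /=; rewrite addrC. Qed.

Lemma functional_add0M : left_id functional_zeroM functional_addM.
Proof. by move=> m; apply: functional_ext => a /=; rewrite add0r. Qed.

HB.instance Definition _ := gen_eqMixin functional.
HB.instance Definition _ := gen_choiceMixin functional.
HB.instance Definition _ := GRing.isNmodule.Build functional
  functional_addMA functional_addMC functional_add0M.

Lemma functional_addE m n a : (m + n) a = m a + n a.
Proof. by []. Qed.

Lemma functional_sumE (L : seq functional) a :
  (\sum_(m <- L) m) a = \sum_(m <- L) m a.
Proof.
by elim: L => [|m L IH]; rewrite ?big_nil// !big_cons functional_addE IH.
Qed.

Definition meet_values m n a :=
  [set r | exists a1 a2, pea_add a1 a2 = Some a /\ r = m a1 + n a2].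

(** The greatest lower bound of m and n in the cone of positive additive
    functionals, for the order m <= n iff n - m is positive. *)
Definition meet_fun m n a := inf (meet_values m n a).

Lemma meet_values_nonempty m n a : meet_values m n a !=set0.
Proof.
by exists (m a + n (pea_zero E)), a, (pea_zero E); rewrite pea_adda0.
Qed.

Lemma meet_le m n a a1 a2 : pea_add a1 a2 = Some a ->
  meet_fun m n a <= m a1 + n a2.
Proof.
move=> a12; apply: ge_inf; last by exists a1, a2.
by exists 0 => _ [b1 [b2 [_ ->]]]; rewrite addr_ge0// functional_ge0.
Qed.

Lemma le_meet m n a r :
  (forall a1 a2, pea_add a1 a2 = Some a -> r <= m a1 + n a2) ->
  r <= meet_fun m n a.
Proof.
move=> h; apply: lb_le_inf; first exact: meet_values_nonempty.
by move=> _ [a1 [a2 [a12 ->]]]; exact: h.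
Qed.

(** A substitute for (a1 + a2) + (b1 + b2) = (a1 + b1) + (a2 + b2), which
    needs commutativity: moving b1 across a2 conjugates a2, but leaves its value
    under every functional unchanged. *)
Lemma pea_interchange a1 a2 a b1 b2 b c :
  pea_add a1 a2 = Some a -> pea_add b1 b2 = Some b -> pea_add a b = Some c ->
  exists c1 c2 a2', [/\ pea_add a1 b1 = Some c1, pea_add a2' b2 = Some c2,
    pea_add c1 c2 = Some c & forall m, m a2' = m a2].
Proof.
move=> a12 b12 abc.
have := pea_addA a b1 b2; rewrite b12 /= abc.
case ab1 : (pea_add a b1) => [u|//] /= ub2.
have := pea_addA a1 a2 b1; rewrite a12 /= ab1.
case a2b1 : (pea_add a2 b1) => [v|//] /= a1v.
(* b1 + e = a2 + b1, so real-valued functionals cannot tell e from a2. *)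
have [_ [e [_ b1e]]] := pea_conj a2b1.
have := pea_addA a1 b1 e; rewrite b1e /= -a1v.
case a1b1 : (pea_add a1 b1) => [c1|//] /= c1e.
have := pea_addA c1 e b2; rewrite c1e /= ub2.
case eb2 : (pea_add e b2) => [c2|//] /= c1c2.
exists c1, c2, e; split=> // m; apply: (addrI (m b1)).
by rewrite -(functional_add m b1e) (functional_add m a2b1) addrC.
Qed.

Hypothesis hE : RDP1 E.

(** Decompositions of a and of b combine to one of a + b by
    [pea_interchange], which gives one inequality; conversely (RDP)_1 splits a
    decomposition of a + b along a and b. *)
Lemma meet_positive_additive m n : positive_additive (meet_fun m n).
Proof.
split=> [a|a b c abc].
  by apply: le_meet => ? ? _; rewrite addr_ge0// functional_ge0.
apply/eqP; rewrite eq_le; apply/andP; split.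
  rewrite -lerBlDr; apply: le_meet => a1 a2 a12.
  rewrite lerBlDr addrC -lerBlDr; apply: le_meet => b1 b2 b12.
  have [c1 [c2 [a2' [a1b1 a2b2 c12 ma2]]]] := pea_interchange a12 b12 abc.
  rewrite lerBlDr (le_trans (meet_le m n c12))//.
  by rewrite (functional_add m a1b1) (functional_add n a2b2) ma2; lra.
apply: le_meet => c1 c2 c12.
have [d1 [d2 [d3 [d4 [d12 d34 d13 d24 _]]]]] := hE c12 abc.
rewrite (functional_add m d12) (functional_add n d34).
by rewrite addrACA lerD// meet_le.
Qed.

Definition meet m n := Functional (meet_positive_additive m n).

Lemma positive_additiveB m n : (forall a, n a <= m a) ->
  positive_additive (fun a => m a - n a).
Proof.
move=> nm; split=> [a|a b c abc]; first by rewrite subr_ge0.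
by rewrite !(functional_add _ abc); lra.
Qed.

(** The cell common to m1 and n1 is their meet; the other cells are
    differences. The last one is positive because n1 - m2 is below both m1 and
    n1. *)
Lemma functional_refinement : refinement_property functional.
Proof.
move=> m1 m2 n1 n2 mn.
have mnE a : m1 a + m2 a = n1 a + n2 a by rewrite -!functional_addE mn.
have pm a : meet m1 n1 a <= m1 a.
  by have := meet_le m1 n1 (pea_adda0 a); rewrite functional_zero addr0.
have pn a : meet m1 n1 a <= n1 a.
  by have := meet_le m1 n1 (pea_add0a a); rewrite functional_zero add0r.
have pm2 a : n1 a - m2 a <= meet m1 n1 a.
  apply: le_meet => a1 a2 a12; rewrite !(functional_add _ a12).
  have := mnE a1; have := functional_ge0 n2 a1; have := functional_ge0 m2 a2.
  by lra.
have p22 a : (n1 a - meet m1 n1 a) <= m2 a by have := pm2 a; lra.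
pose B := Functional (positive_additiveB pm).
pose C := Functional (positive_additiveB pn).
have p22' a : C a <= m2 a by exact: p22.
pose D := Functional (positive_additiveB p22').
exists (meet m1 n1), B, C, D; split; apply: functional_ext => a;
  rewrite functional_addE /=; have := mnE a; lra.
Qed.

End Functionals.

(** * Decompositions of a state *)

Section Homogenization.
Variables (R : realType) (E : pseudoEffectAlgebra) (s : states R E).
Implicit Types (m n : functional R E) (f g : states R E -> R).

Lemma states_is_state (x : states R E) : is_state (\val x).
Proof. exact: set_valP. Qed.

Lemma state_positive_additive (x : states R E) : positive_additive (\val x).
Proof.
have [x01 xD _] := states_is_state x; split=> // a.
by have /andP[] := x01 a.
Qed.

Definition state_functional x := Functional (state_positive_additive x).

Lemma states_ext (x y : states R E) : (forall a, hat a x = hat a y) -> x = y.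
Proof. by move=> xy; apply: val_inj; exact: funext. Qed.

Lemma is_state_normalize m : m (pea_one E) != 0 ->
  is_state (fun a => m a / m (pea_one E)).
Proof.
move=> m1; have mp : 0 < m (pea_one E) by rewrite lt_def m1 functional_ge0.
split=> [a|a b c abc|]; last by rewrite divff.
  by rewrite divr_ge0 ?functional_ge0//= ler_pdivrMr// mul1r functional_le_one.
by rewrite (functional_add m abc) mulrDl.
Qed.

(** The state proportional to m; s is a default value for m = 0. *)
Definition normalize m : states R E :=
  if pselect (is_state (fun a => m a / m (pea_one E))) is left H
  then exist (fun x => x \in states R E) _ (mem_set (A := states R E) H) else s.

Lemma hat_normalize m a : m a = m (pea_one E) * hat a (normalize m).
Proof.
have [m1|m1] := eqVneq (m (pea_one E)) 0.
  rewrite m1 mul0r; apply/eqP; rewrite eq_le functional_ge0 -m1.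
  by rewrite functional_le_one.
rewrite /normalize; case: pselect => [H|]; last first.
  by move=> H; case: H; exact: is_state_normalize.
by rewrite /hat /= mulrC divfK.
Qed.

(** The extension of f, a function on states, to a positively homogeneous
    function on the cone of functionals. *)
Definition homogenize f m := m (pea_one E) * f (normalize m).

Lemma homogenize_state f x : homogenize f (state_functional x) = f x.
Proof.
have [_ _ x1] := states_is_state x.
rewrite /homogenize /= x1 mul1r; congr f; apply: states_ext => a.
by have := hat_normalize (state_functional x) a; rewrite /= x1 mul1r.
Qed.

(** The state of m + n is the convex combination of those of m and n with
    weights proportional to the masses m(1) and n(1). *)
Lemma homogenize_subadditive f : convex_on f -> subadditive (homogenize f).
Proof.
move=> cf; rewrite /homogenize; split=> [|m n]; first by rewrite mul0r.
pose e := pea_one E; rewrite -/e.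
have [m0|m0] := eqVneq (m e) 0.
  have -> : m = 0.
    by apply: functional_ext => a; rewrite hat_normalize m0 mul0r.
  by rewrite mul0r !add0r.
have mp : 0 < m e by rewrite lt_def m0 functional_ge0.
have np : 0 <= n e by rewrite functional_ge0.
have mnp : 0 < m e + n e by rewrite ltr_wpDr.
have t01 : 0 <= m e / (m e + n e) <= 1.
  by rewrite divr_ge0 ?(ltW mp) ?(ltW mnp)//= ler_pdivrMr// mul1r lerDl.
have t1 : 1 - m e / (m e + n e) = n e / (m e + n e).
  by rewrite -[1](divff (lt0r_neq0 mnp)) -mulrBl addrC addKr.
have := cf (normalize m) (normalize n) (normalize (m + n)) _ t01.
rewrite t1 functional_addE -ler_pdivlMl// => h.
rewrite (le_trans (h _))//; last first.
  by rewrite mulrDr !mulrA ![_^-1 * _]mulrC.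
apply: funext => a.
apply: (mulfI (lt0r_neq0 mnp)).
have := hat_normalize (m + n) a; rewrite /hat !functional_addE => <-.
rewrite hat_normalize (hat_normalize n) /hat -/e.
change (m e * \val (normalize m) a + n e * \val (normalize n) a =
  (m e + n e) * (m e / (m e + n e) * \val (normalize m) a +
     n e / (m e + n e) * \val (normalize n) a)).
by rewrite mulrDr; congr (_ + _);
  rewrite mulrA [in RHS]mulrCA divff ?mulr1// lt0r_neq0.
Qed.

(** Such a list is a finitely supported probability on the states with
    barycenter s, and [partition_sum] is the integral of f against it. *)
Definition state_partition (L : seq (functional R E)) :=
  \sum_(m <- L) m = state_functional s.

Definition partition_sum f (L : seq (functional R E)) :=
  \sum_(m <- L) homogenize f m.

Lemma partition_mass L : state_partition L -> \sum_(m <- L) m (pea_one E) = 1.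
Proof.
by move=> Ls; rewrite -functional_sumE Ls /=; case: (states_is_state s).
Qed.

Lemma partition_sumD f g L :
  partition_sum (fun x => f x + g x) L = partition_sum f L + partition_sum g L.
Proof.
by rewrite /partition_sum -big_split; apply: eq_bigr => m _; exact: mulrDr.
Qed.

Lemma partition_sumZ k f L :
  partition_sum (fun x => k * f x) L = k * partition_sum f L.
Proof.
by rewrite /partition_sum mulr_sumr; apply: eq_bigr => m _; exact: mulrCA.
Qed.

Lemma partition_sum_le f g L : (forall x, f x <= g x) ->
  partition_sum f L <= partition_sum g L.
Proof.
by move=> fg; apply: ler_sum => m _; rewrite ler_wpM2l// functional_ge0.
Qed.

Lemma partition_sum_cst k L : state_partition L -> partition_sum (fun=> k) L = k.
Proof.
by move=> Ls; rewrite /partition_sum -mulr_suml partition_mass// mul1r.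
Qed.

(** The filter of the net of all decompositions of s, directed by
    refinement. *)
Definition finer_filter : set_system (seq (functional R E)) :=
  [set A | exists2 L0, state_partition L0 &
    forall L, state_partition L -> finer R L L0 -> A L].

Lemma finer_filter_proper : RDP1 E -> ProperFilter finer_filter.
Proof.
move=> hE; apply: Build_ProperFilter_ex.
  move=> A [L Ls]; move=> /(_ L Ls (finer_refl L)) AL.
  by exists L.
split.
- by exists [:: state_functional s]; rewrite /state_partition ?big_seq1.
- move=> A B [L1 L1s A1] [L2 L2s B2].
  have [|L [LL1 fL1 fL2]] :=
    @common_refinement R _ (functional_refinement hE) L1 L2; first by rewrite L1s.
  exists L; first by rewrite /state_partition LL1.
  by move=> L' L's fL'; split; [apply: A1|apply: B2] => //;
    apply: finer_trans fL' _.
- by move=> A B AB [L Ls AL]; exists L => // L' *; apply: AB; exact: AL.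
Qed.

End Homogenization.

(** * Finitely additive means and the limit over decompositions *)

Section Means.
Variables (R : realType) (T : Type).
Implicit Types f g : T -> R.

Definition is_bounded f := exists B, forall x, `|f x| <= B.

(** A positive normalized linear functional on the bounded functions,
    continuous or not; its value on an unbounded function is arbitrary. *)
Definition is_mean (I : (T -> R) -> R) :=
  [/\ forall f g, is_bounded f -> is_bounded g ->
        I (fun x => f x + g x) = I f + I g,
      forall k f, is_bounded f -> I (fun x => k * f x) = k * I f,
      forall f g, is_bounded f -> is_bounded g -> (forall x, f x <= g x) ->
        I f <= I g
    & I (fun=> 1) = 1].

End Means.

Lemma ultrafilter_fmap (T U : Type) (f : T -> U) (F : set_system T) :
  UltraFilter F -> UltraFilter (f @ F).
Proof.
move=> FU; split; first exact: fmap_proper_filter.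
move=> G GF fG; rewrite eqEsubset; split=> // A GA.
have [//|FnA] := in_ultra_setVsetC (f @^-1` A) FU.
have GnA : G (~` A) by exact: fG.
by have [x []] := filter_ex (filterI GA GnA).
Qed.

(** The limit of the sums over decompositions of s along an ultrafilter
    finer than refinement. Sums of a convex function increase along refinement,
    so none of them exceeds the limit. *)
Lemma exists_mean (R : realType) (E : pseudoEffectAlgebra) (s : states R E) :
  RDP1 E -> exists I, is_mean I /\ forall f, is_bounded f -> convex_on f ->
    forall L, state_partition s L -> partition_sum s f L <= I f.
Proof.
move=> hE; have [G [GU FG]] := ultraFilterLemma (finer_filter_proper s hE).
have GF : ProperFilter G := ultra_proper.
have Gpart : G [set L | state_partition s L].
  by apply: FG; exists [:: state_functional s]; rewrite /state_partition ?big_seq1.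
have cvgG f : is_bounded f -> cvg (partition_sum s f @ G).
  move=> [B fB].
  have GB : (partition_sum s f @ G) `[- B, B]%classic.
    rewrite /fmap /=; apply: filterS Gpart => L Ls /=; rewrite in_itv /=.
    rewrite -(partition_sum_cst (- B) Ls) -{2}(partition_sum_cst B Ls).
    by apply/andP; split; apply: partition_sum_le => x;
      have := fB x; rewrite ler_norml => /andP[].
  have := @segment_compact R (- B) B; rewrite compact_ultra.
  move=> /(_ (partition_sum s f @ G)) [|//|l [_ Gl]].
    exact: ultrafilter_fmap.
  by apply/cvg_ex; exists l.
exists (fun f => lim (partition_sum s f @ G)); split; first split.
- move=> f g bf bg; rewrite -limD; [|exact: cvgG..].
  by congr (lim (_ @ G)); apply: funext => L; rewrite partition_sumD.
- move=> k f bf; have -> : partition_sum s (fun x => k * f x) =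
      (fun L => k * partition_sum s f L).
    by apply: funext => L; rewrite partition_sumZ.
  by apply: cvg_lim => //; apply: cvgM; [exact: cvg_cst|exact: cvgG].
- move=> f g bf bg fg; rewrite -subr_ge0 -limB; [|exact: cvgG..].
  apply: limr_ge; first by apply: is_cvgB; exact: cvgG.
  by apply: nearW => L; rewrite /= subr_ge0 partition_sum_le.
- apply: cvg_lim => // A /nbhs_singleton A1.
  suff : G [set L | A (partition_sum s (fun=> 1) L)] by [].
  by apply: filterS Gpart => L Ls /=; rewrite (partition_sum_cst _ Ls).
- move=> f bf cf L Ls; apply: limr_ge; first exact: cvgG.
  apply: FG; exists L => // L' _ fL; exact: fL (homogenize_subadditive s cf).
Qed.

(** * Continuous and bounded functions *)

Section BoundedFunctions.
Variables (R : realType) (T : Type).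
Implicit Types f g : T -> R.

Lemma is_bounded_cst (k : R) : is_bounded (fun _ : T => k).
Proof. by exists `|k|. Qed.

Lemma is_boundedD f g : is_bounded f -> is_bounded g ->
  is_bounded (fun x => f x + g x).
Proof.
move=> [A fA] [B gB]; exists (A + B) => x.
by rewrite (le_trans (ler_normD _ _))// lerD.
Qed.

Lemma is_boundedZ k f : is_bounded f -> is_bounded (fun x => k * f x).
Proof.
by move=> [A fA]; exists (`|k| * A) => x; rewrite normrM ler_wpM2l.
Qed.

Lemma is_bounded_indic (A : set T) : is_bounded (\1_A : T -> R).
Proof.
by exists 1 => x; rewrite indicE; case: (x \in A); rewrite ?normr1 ?normr0.
Qed.

Lemma is_bounded_sum n (F : 'I_n -> T -> R) : (forall k, is_bounded (F k)) ->
  is_bounded (fun x => \sum_(k < n) F k x).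
Proof.
elim: n F => [|n IH] F bF.
  by under eq_fun do rewrite big_ord0; exact: is_bounded_cst.
under eq_fun do rewrite big_ord_recl.
by apply: is_boundedD => //; apply: IH.
Qed.

End BoundedFunctions.

Section ContinuousRealFunctions.
Variables (R : realType) (T : topologicalType).
Implicit Types f g : T -> R.

Lemma continuous_funD f g : continuous f -> continuous g ->
  continuous (fun x => f x + g x).
Proof. by move=> cf cg x; apply: cvgD; [exact: cf|exact: cg]. Qed.

Lemma continuous_funB f g : continuous f -> continuous g ->
  continuous (fun x => f x - g x).
Proof. by move=> cf cg x; apply: cvgB; [exact: cf|exact: cg]. Qed.

Lemma continuous_funZ k f : continuous f -> continuous (fun x => k * f x).
Proof. by move=> cf x; apply: cvgM; [exact: cvg_cst|exact: cf]. Qed.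

Lemma continuous_fun_norm f : continuous f -> continuous (fun x => `|f x|).
Proof. by move=> cf x; apply: cvg_norm; exact: cf. Qed.

Lemma continuous_fun_max f g : continuous f -> continuous g ->
  continuous (fun x => Num.max (f x) (g x)).
Proof. by move=> cf cg x; apply: continuous_max; [exact: cf|exact: cg]. Qed.

End ContinuousRealFunctions.

(** * Integrals of bounded functions *)

Section BoundedIntegrals.
Context {d : measure_display} {T : measurableType d} {R : realType}.
Variable mu : probability T R.
Implicit Types (f g : T -> R) (D : set T).

Lemma bounded_integrable D f : measurable D -> measurable_fun setT f ->
  is_bounded f -> mu.-integrable D (EFin \o f).
Proof.
move=> mD mf [B fB]; apply: measurable_bounded_integrable => //.
- by rewrite (le_lt_trans (probability_le1 mu mD))// ltry.
- exact: measurable_funS mf.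
- by exists B; split; [exact: num_real|move=> M BM x _; exact: le_trans (ltW BM)].
Qed.

Lemma EFin_Rintegral D f : measurable D -> measurable_fun setT f ->
  is_bounded f -> (\int[mu]_(x in D) (f x)%:E = (\int[mu]_(x in D) f x)%:E)%E.
Proof.
move=> mD mf bf; rewrite /Rintegral fineK//.
by apply: integrable_fin_num => //; exact: bounded_integrable.
Qed.

Lemma Rintegral_cst1 r : \int[mu]_x r = r.
Proof.
rewrite Rintegral_cst// -[RHS]mulr1; congr (r * _).
by rewrite -[RHS]/(fine 1%E); congr fine; exact: probability_setT.
Qed.

Lemma Rintegral_sum n (F : 'I_n -> T -> R) :
  (forall k, measurable_fun setT (F k)) -> (forall k, is_bounded (F k)) ->
  \int[mu]_x (\sum_(k < n) F k x) = \sum_(k < n) \int[mu]_x F k x.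
Proof.
elim: n F => [|n IH] F mF bF.
  rewrite big_ord0 -[RHS](Rintegral_cst1 0); apply: eq_Rintegral => x _.
  by rewrite big_ord0.
rewrite big_ord_recl -IH// -RintegralD//.
- by apply: eq_Rintegral => x _; rewrite big_ord_recl.
- exact: bounded_integrable.
- apply: bounded_integrable => //; last exact: is_bounded_sum.
  exact: measurable_sum.
Qed.

Lemma Rintegral_indic A : measurable A -> \int[mu]_x (\1_A x : R) = fine (mu A).
Proof. by move=> mA; rewrite /Rintegral integral_indic// setIT. Qed.

End BoundedIntegrals.

Section BorelFunctions.
Variables (R : realType) (T : ptopologicalType).
Notation borelT := (g_sigma_algebraType (@open T)).

Lemma borel_open (O : set T) : open O -> measurable (O : set borelT).
Proof. exact: sub_sigma_algebra. Qed.

Lemma borel_closed (C : set T) : closed C -> measurable (C : set borelT).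
Proof.
move=> cC; rewrite -[C]setCK; apply: measurableC.
by apply: borel_open; exact: closed_openC.
Qed.

Lemma continuous_borel (f : T -> R) : continuous f ->
  measurable_fun setT (f : borelT -> R).
Proof.
move=> /continuousP cf; apply: (measurability _ (RGenOpens.measurableE R)).
move=> _ [_ [a [b ->] <-]]; rewrite setTI; apply: borel_open.
by apply: cf; exact: interval_open.
Qed.

Lemma continuous_is_bounded (f : T -> R) :
  compact [set: T] -> continuous f -> is_bounded f.
Proof.
move=> cT cf.
have : compact (f @` setT).
  by apply: continuous_compact => //; apply: continuous_subspaceT.
move=> /compact_bounded [M [_ Mf]]; exists (M + 1) => x.
by apply: Mf; [rewrite ltrDl|exists x].
Qed.

End BorelFunctions.

Section LayerCake.
Variable R : realType.

Lemma layers_le (z : R) n : 0 <= z -> \sum_(k < n) ((k.+1%:R <= z)%R%:R : R) <= z.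
Proof.
move=> z0; suff [] : \sum_(k < n) ((k.+1%:R <= z)%R%:R : R) <= z /\
  \sum_(k < n) ((k.+1%:R <= z)%R%:R : R) <= n%:R by [].
elim: n => [|n [IH1 IH2]]; first by rewrite big_ord0.
rewrite big_ord_recr /=; case: (leP n.+1%:R z) => [nz|_]; last first.
  by rewrite /= ?mulr0n addr0; split=> //; rewrite (le_trans IH2)// ler_nat.
have H : \sum_(i < n) ((i.+1%:R <= z)%R%:R : R) + 1 <= n.+1%:R.
  by rewrite -natr1 lerD2r.
by split=> //; exact: le_trans H nz.
Qed.

(** The sum counts the integers in [1, z], so that z exceeds it by at most
    one. *)
Lemma le_layers (z : R) n : z <= n%:R ->
  z <= 1 + \sum_(k < n) ((k.+1%:R <= z)%R%:R : R).
Proof.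
move=> zn; suff [//|] : z <= 1 + \sum_(k < n) ((k.+1%:R <= z)%R%:R : R) \/
    n%:R <= \sum_(k < n) ((k.+1%:R <= z)%R%:R : R).
  by move=> h; rewrite (le_trans zn)// (le_trans h)// lerDr.
elim: n {zn} => [|n IH]; first by right; rewrite big_ord0.
rewrite big_ord_recr/=; case: IH => IH.
  by left; rewrite (le_trans IH)// addrA lerDl ler0n.
case: (leP n.+1%:R z) => nz; first by right; rewrite -natr1 lerD2r.
left; rewrite /= ?mulr0n addr0 (le_trans (ltW nz))// -natr1 addrC lerD2l.
exact: IH.
Qed.

End LayerCake.

(** * The representing measure of a mean *)

Section MeanRepresentation.
Variables (R : realType) (T : ptopologicalType).
Hypotheses (hausT : hausdorff_space T) (cptT : compact [set: T]).
Variable I : (T -> R) -> R.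
Hypothesis meanI : is_mean I.
Implicit Types (A B C O : set T).

Lemma meanD f g : is_bounded f -> is_bounded g ->
  I (fun x => f x + g x) = I f + I g.
Proof. by case: meanI => + _ _ _; apply. Qed.

Lemma meanZ k f : is_bounded f -> I (fun x => k * f x) = k * I f.
Proof. by case: meanI => _ + _ _; apply. Qed.

Lemma mean_le f g : is_bounded f -> is_bounded g -> (forall x, f x <= g x) ->
  I f <= I g.
Proof. by case: meanI => _ _ + _; apply. Qed.

Lemma mean_cst k : I (fun=> k) = k.
Proof.
have := meanZ k (is_bounded_cst T 1); case: meanI => _ _ _ ->; rewrite mulr1 => {2}<-.
by congr I; apply: funext => x; rewrite mulr1.
Qed.

Lemma mean_sum n (F : 'I_n -> T -> R) : (forall k, is_bounded (F k)) ->
  I (fun x => \sum_(k < n) F k x) = \sum_(k < n) I (F k).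
Proof.
elim: n F => [|n IH] F bF.
  by rewrite big_ord0; under eq_fun do rewrite big_ord0; exact: mean_cst.
rewrite big_ord_recl -IH// -meanD//; last exact: is_bounded_sum.
by congr I; apply: funext => x; rewrite big_ord_recl.
Qed.

(** The finitely additive probability on all subsets attached to I. *)
Definition mean_set A := I (\1_A).

Lemma mean_set_le A B : A `<=` B -> mean_set A <= mean_set B.
Proof.
move=> AB; apply: mean_le; [exact: is_bounded_indic..|move=> x].
rewrite !indicE ler_nat; case: (boolP (x \in A)) => //= xA.
by rewrite (_ : x \in B)//; apply/mem_set/AB/set_mem.
Qed.

Lemma mean_set0 : mean_set set0 = 0.
Proof. by rewrite /mean_set indic0; exact: mean_cst. Qed.

Lemma mean_setT : mean_set setT = 1.
Proof. by rewrite /mean_set indicT; exact: mean_cst. Qed.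

Lemma mean_set_le1 A : mean_set A <= 1.
Proof. by rewrite -mean_setT; apply: mean_set_le. Qed.

Lemma mean_setU A B : A `&` B = set0 -> mean_set (A `|` B) = mean_set A + mean_set B.
Proof.
move=> AB; rewrite /mean_set -meanD; [|exact: is_bounded_indic..].
congr I; apply: funext => x; rewrite !indicE in_setU.
case: (boolP (x \in A)) => xA; case: (boolP (x \in B)) => xB;
  rewrite ?addr0 ?add0r//.
by have : (A `&` B) x by [split; exact: set_mem]; rewrite AB.
Qed.

Lemma mean_set_leU A B C : A `<=` B `|` C -> mean_set A <= mean_set B + mean_set C.
Proof.
move=> ABC; rewrite (@le_trans _ _ (mean_set (B `|` (C `\` B))))//.
  apply: mean_set_le => x /ABC[Bx|Cx]; first by left.
  by have [Bx|Bx] := pselect (B x); [left|right].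
rewrite mean_setU; first by rewrite lerD2l mean_set_le// => x [].
by rewrite setDE setICA setICr setI0.
Qed.

Local Open Scope ereal_scope.

(** The open sets are measured by approximation from inside by closed sets,
    then all sets from outside by open sets. This turns the finitely additive
    [mean_set] into an outer measure. *)
Definition inner O : \bar R :=
  ereal_sup [set (mean_set C)%:E | C in [set C | closed C /\ C `<=` O]].

Definition outer (A : set T) : \bar R :=
  ereal_inf [set inner O | O in [set O | open O /\ A `<=` O]].

Lemma le_inner O A : A `<=` O -> inner A <= inner O.
Proof.
move=> AO; apply: le_ereal_sup => _ [C [cC CA] <-].
by exists C => //; split=> //; exact: subset_trans AO.
Qed.

Lemma mean_set_le_inner C O : closed C -> C `<=` O -> (mean_set C)%:E <= inner O.
Proof. by move=> cC CO; apply: ereal_sup_ubound; exists C. Qed.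

Lemma inner_ge0 O : 0 <= inner O.
Proof.
by have := mean_set_le_inner closed0 (@sub0set _ O); rewrite mean_set0.
Qed.

Lemma inner_le1 O : inner O <= 1.
Proof. by apply: ge_ereal_sup => _ [C _ <-]; rewrite lee_fin mean_set_le1. Qed.

Lemma inner_fin_num O : inner O \is a fin_num.
Proof.
rewrite ge0_fin_numE ?inner_ge0//; exact: le_lt_trans (inner_le1 O) (ltry _).
Qed.

Lemma innerT : inner setT = 1.
Proof.
apply/eqP; rewrite eq_le inner_le1/=.
by have := mean_set_le_inner closedT (@subsetT _ setT); rewrite mean_setT.
Qed.

Lemma inner0 : inner set0 = 0.
Proof.
apply/eqP; rewrite eq_le inner_ge0 andbT.
apply: ge_ereal_sup => _ [C [_ C0] <-].
by move: C0; rewrite subset0 => ->; rewrite mean_set0.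
Qed.

Lemma inner_approx O (e : R) : (0 < e)%R ->
  exists C, [/\ closed C, C `<=` O & inner O <= (mean_set C)%:E + e%:E].
Proof.
move=> e0; have [_ [C [cC CO] <-] h] := ub_ereal_sup_adherent e0 (inner_fin_num O).
by exists C; split=> //; rewrite -leeBlDr// ltW.
Qed.

Lemma outer_open O : open O -> outer O = inner O.
Proof.
move=> oO; apply/eqP; rewrite eq_le; apply/andP; split.
  by apply: ereal_inf_lbound; exists O => //; split.
by apply: le_ereal_inf_tmp => _ [A [_ OA] <-]; exact: le_inner.
Qed.

Lemma outer_ge0 A : 0 <= outer A.
Proof. by apply: le_ereal_inf_tmp => _ [ O _ <-]; exact: inner_ge0. Qed.

Lemma le_outer A B : A `<=` B -> outer A <= outer B.
Proof.
move=> AB; apply: ereal_inf_le_tmp => _ [ O [oO BO] <-].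
by exists O => //; split=> //; exact: subset_trans BO.
Qed.

Lemma outer_le1 A : outer A <= 1.
Proof.
by rewrite (le_trans (@le_outer A setT _))// outer_open ?innerT//; exact: openT.
Qed.

Lemma outer0 : outer set0 = 0.
Proof. by rewrite outer_open ?inner0//; exact: open0. Qed.

Lemma outer_fin_num A : outer A \is a fin_num.
Proof.
rewrite ge0_fin_numE ?outer_ge0//; exact: le_lt_trans (outer_le1 A) (ltry _).
Qed.

Lemma outer_approx A (e : R) : (0 < e)%R ->
  exists O, [/\ open O, A `<=` O & inner O <= outer A + e%:E].
Proof.
move=> e0; have [_ [ O [oO AO] <-] h] := lb_ereal_inf_adherent e0 (outer_fin_num A).
by exists O; split=> //; exact: ltW.
Qed.

(** In a normal space, a closed set covered by n + 1 open sets is the union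
    of a closed part of the last one and a closed set covered by the others. *)
Lemma mean_set_bigcup n (O : nat -> set T) C : (forall i, open (O i)) ->
  closed C -> C `<=` \bigcup_(i in `I_n) O i ->
  (mean_set C)%:E <= \sum_(i < n) inner (O i).
Proof.
move=> oO; elim: n C => [|n IH] C cC CO.
  rewrite big_ord0; have -> : C = set0.
    by rewrite -subset0 => x /CO[i].
  by rewrite mean_set0.
pose U := \bigcup_(i in `I_n) O i.
have oU : open U by apply: bigcup_open => i _; exact: oO.
have cCO : closed (C `\` O n) by apply: closedI cC _; exact: open_closedC.
have CU : C `\` O n `<=` U.
  move=> x [/CO[i /= + Oix] nOx]; rewrite ltnS leq_eqVlt => /orP[/eqP ni|i_n].
    by move: nOx; rewrite -ni.
  by exists i.
have : set_nbhs (C `\` O n) U by apply/set_nbhsP; exists U; split.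
move=> /(compact_normal hausT cptT cCO)[V /set_nbhsP[W [oW CW WV]] VU].
have c1 : closed (C `&` closure V) by apply: closedI cC _; exact: closed_closure.
have c2 : closed (C `\` W) by apply: closedI cC _; exact: open_closedC.
have h1 : C `&` closure V `<=` U by move=> x [_ /VU].
have h2 : C `\` W `<=` O n.
  by move=> x [Cx nWx]; apply: contrapT => nOx; apply: nWx; apply: CW.
rewrite big_ord_recr/=.
apply: (@le_trans _ _ (mean_set (C `&` closure V) + mean_set (C `\` W))%:E).
  rewrite lee_fin; apply: mean_set_leU => x Cx.
  have [Wx|Wx] := pselect (W x); [left; split=> //|by right].
  by apply: subset_closure; exact: WV.
by rewrite EFinD leeD ?IH// mean_set_le_inner.
Qed.

(** Compactness reduces the countable cover to a finite one. *)
Lemma inner_bigcup (O : nat -> set T) : (forall i, open (O i)) ->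
  inner (\bigcup_i O i) <= \sum_(i <oo) inner (O i).
Proof.
move=> oO; apply: ge_ereal_sup => _ [C [cC CO] <-].
have : compact C by exact: subclosed_compact cC cptT _.
rewrite compact_cover => /(_ nat setT O (fun i _ => oO i) CO)[D _ CD].
pose n := (\max_(i <- finmap.enum_fset D) i).+1.
apply: (@le_trans _ _ (\sum_(i < n) inner (O i))).
  apply: mean_set_bigcup => // x /CD[i /= iD Oix]; exists i => //=.
  by rewrite ltnS; exact: (@leq_bigmax_seq _ _ xpredT id).
rewrite -(big_mkord xpredT (fun i => inner (O i))).
by apply: nneseries_lim_ge => i _ _; exact: inner_ge0.
Qed.

Lemma outer_sigma_subadditive : sigma_subadditive outer.
Proof.
move=> A; apply/lee_addgt0Pr => e e0.
apply: le_trans (epsilon_trick _ _ (ltW e0)); last by move=> n; exact: outer_ge0.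
have /choice[ O OP] : forall n, exists O, [/\ open O, A n `<=` O &
    inner O <= outer (A n) + (e / (2 ^ n.+1)%:R)%:E].
  by move=> n; apply: outer_approx; rewrite divr_gt0.
apply: (@le_trans _ _ (inner (\bigcup_i O i))).
  apply: ereal_inf_lbound; exists (\bigcup_i O i) => //; split.
    by apply: bigcup_open => i _; case: (OP i).
  by apply: subset_bigcup => i _; case: (OP i).
apply: le_trans (inner_bigcup _) _; first by move=> i; case: (OP i).
apply: lee_nneseries => i _ *; first exact: inner_ge0.
by case: (OP i).
Qed.

Definition outer_pack : {outer_measure set T -> \bar R} :=
  HB.pack_for {outer_measure set T -> \bar R} outer
    (isOuterMeasure.Build R T outer outer0 outer_ge0 le_outer
      outer_sigma_subadditive).

(** Inside an open W containing A, approximate W `&` O by a closed C and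
    then the open set W `\` C by a closed C'. These are disjoint, so their
    masses add up to at most that of W. *)
Lemma open_caratheodory O : open O -> outer.-caratheodory O.
Proof.
move=> oO; apply: (@le_caratheodory_measurable R T outer_pack) => A /=.
apply/lee_addgt0Pr => e e0; have e20 : (0 < e / 2)%R by rewrite divr_gt0.
have e40 : (0 < e / 2 / 2)%R by rewrite divr_gt0.
have [W [oW AW hW]] := outer_approx A e20.
have [C [cC CWO hC]] := inner_approx (W `&` O) e40.
have [C' [cC' CWC hC']] := inner_approx (W `\` C) e40.
have oWC : open (W `\` C) by apply: openI => //; exact: closed_openC.
have h1 : outer (A `&` O) <= inner (W `&` O).
  by rewrite -outer_open; [apply: le_outer; exact: setSI|exact: openI].
have h2 : outer (A `&` ~` O) <= inner (W `\` C).
  rewrite -outer_open//; apply: le_outer => x [Ax Ox]; split; first exact: AW.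
  by move=> /CWO[].
have hCC' : ((mean_set C)%:E + (mean_set C')%:E <= inner W).
  rewrite -EFinD -mean_setU; last first.
    by rewrite -subset0 => x [Cx /CWC[]].
  apply: mean_set_le_inner; first exact: closedU.
  by move=> x [/CWO[]//|/CWC[]].
apply: le_trans (leeD (le_trans h1 hC) (le_trans h2 hC')) _.
rewrite addeACA -EFinD -splitr; have h := le_trans hCC' hW.
rewrite (le_trans (leeD2r (e / 2)%:E h))//.
by rewrite -addeA -EFinD -splitr.
Qed.

Notation borelT := (g_sigma_algebraType (@open T)).

Lemma borel_caratheodory (A : set borelT) :
  measurable A -> outer.-caratheodory A.
Proof.
apply: smallest_sub; last by move=> O; exact: open_caratheodory.
exact: (@sigma_algebra_measurable _ (caratheodory_type outer_pack)).
Qed.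

Definition mean_measure (A : set borelT) : \bar R := outer A.

Lemma mean_measure_semi_sigma_additive : semi_sigma_additive mean_measure.
Proof.
move=> A mA tA mbigA.
apply: (@caratheodory_measure_sigma_additive R T outer_pack A) => //.
- by move=> n; exact: borel_caratheodory.
- exact: borel_caratheodory.
Qed.

HB.instance Definition _ := isMeasure.Build _ borelT R mean_measure
  outer0 outer_ge0 mean_measure_semi_sigma_additive.

Lemma mean_measureT : mean_measure setT = 1.
Proof. by rewrite /mean_measure outer_open ?innerT//; exact: openT. Qed.

HB.instance Definition _ :=
  Measure_isProbability.Build _ borelT R mean_measure mean_measureT.

(** Outer regularity is the definition; inner regularity follows by
    complements. *)
Lemma mean_measure_regular (Y : set borelT) : measurable Y ->
  ereal_inf [set mean_measure O | O in [set O : set T | open O /\ Y `<=` O]] =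
    mean_measure Y /\
  mean_measure Y =
    ereal_sup [set mean_measure C | C in [set C : set T | closed C /\ C `<=` Y]].
Proof.
move=> mY; split.
  congr ereal_inf; apply/seteqP; split=> _ [ O [oO YO] <-]; exists O => //;
    by rewrite /mean_measure outer_open.
apply/eqP; rewrite eq_le; apply/andP; split; last first.
  by apply: ge_ereal_sup => _ [C [_ CY] <-]; exact: le_outer.
apply/lee_addgt0Pr => e e0.
have [ O [oO YO hO]] := outer_approx (~` Y) e0.
have mO : measurable (O : set borelT) by exact: borel_open.
apply: (@le_trans _ _ (mean_measure (~` O) + e%:E)); last first.
  rewrite leeD2r//; apply: ereal_sup_ubound; exists (~` O) => //; split.
    exact: open_closedC.
  by move=> x nOx; apply: contrapT => /YO.
have setCE (A : set borelT) : measurable A -> outer (~` A) = 1 - outer A.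
  exact: (probability_setC mean_measure).
move: hO; rewrite -outer_open// /mean_measure !setCE//.
have := outer_fin_num O; have := outer_fin_num Y.
move: (outer O) (outer Y) => [x| |] [y| |]//= _ _.
rewrite -!EFinD !lee_fin => h; lra.
Qed.

Local Open Scope ring_scope.

(** The converse inequality fails in general: I may put mass outside C but
    arbitrarily close to it. This is why the comparison of integrals starts from
    closed level sets. *)
Lemma mean_set_closed_le C : closed C -> ((mean_set C)%:E <= mean_measure C)%E.
Proof.
move=> cC; apply: le_ereal_inf_tmp => _ [ O [_ CO] <-].
exact: mean_set_le_inner.
Qed.

(** Layer cake: up to 1/N, the function f is the average of the indicators
    of its closed level sets, whose mean is at most their measure. *)
Lemma mean_le_integral01 (f : T -> R) : continuous f ->
  (forall x, 0 <= f x <= 1) ->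
  I f <= \int[mean_measure]_(x in (setT : set borelT)) f x.
Proof.
move=> cf f01; apply/ler_addgt0Pr => e e0.
pose N := (Num.truncn e^-1).+1; have N0 : 0 < N%:R :> R by rewrite ltr0n.
have Ne : N%:R^-1 <= e.
  by rewrite -[e]invrK lef_pV2 ?posrE ?invr_gt0//; exact/ltW/truncnS_gt.
pose C (k : 'I_N) := [set x | k.+1%:R <= f x * N%:R].
have cC k : closed (C k).
  pose g := fun x => f x * N%:R.
  have -> : C k = g @^-1` [set y | k.+1%:R <= y] by [].
  apply: closed_comp; last exact: closed_ge.
  by move=> x _; apply: cvgM; [exact: cf|exact: cvg_cst].
pose g x := \sum_(k < N) N%:R^-1 * (\1_(C k) x : R).
have gE x : g x = N%:R^-1 * \sum_(k < N) ((k.+1%:R <= f x * N%:R)%R%:R : R).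
  rewrite mulr_sumr; apply: eq_bigr => k _; rewrite indicE; congr (_ * _%:R).
  by congr nat_of_bool; apply/idP/idP => [/set_mem|/mem_set].
have fg x : f x <= N%:R^-1 + g x.
  have /andP[f0 f1] := f01 x.
  have := @le_layers R (f x * N%:R) N; rewrite ler_piMl// => /(_ isT) h.
  by rewrite gE -[X in X + _]mulr1 -mulrDr ler_pdivlMl// [leLHS]mulrC.
have gf x : g x <= f x.
  have /andP[f0 f1] := f01 x.
  have := @layers_le R (f x * N%:R) N; rewrite mulr_ge0// => /(_ isT) h.
  by rewrite gE ler_pdivrMl// [leRHS]mulrC.
have bk k : is_bounded (fun x => N%:R^-1 * (\1_(C k) x : R)).
  exact/is_boundedZ/is_bounded_indic.
have bg : is_bounded g by exact: is_bounded_sum.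
have bf : is_bounded f by exact: continuous_is_bounded.
have If : I f <= N%:R^-1 + \sum_(k < N) N%:R^-1 * mean_set (C k).
  rewrite -[X in X + _]mean_cst.
  under eq_bigr do rewrite -(meanZ _ (is_bounded_indic R _)).
  rewrite -mean_sum// -meanD//; last exact: is_bounded_cst.
  by apply: mean_le => //; apply: is_boundedD => //; exact: is_bounded_cst.
apply: (le_trans If); rewrite addrC lerD//.
have mC k : measurable (C k : set borelT) by exact: borel_closed.
have mf : measurable_fun setT (f : borelT -> R) by exact: continuous_borel.
have mk k : measurable_fun setT
    ((fun x => N%:R^-1 * (\1_(C k) x : R)) : borelT -> R).
  by apply: measurable_funM => //; exact: measurable_indic.
have mg : measurable_fun setT (g : borelT -> R) by exact: measurable_sum.
apply: (@le_trans _ _ (\int[mean_measure]_(x in (setT : set borelT)) g x)); last first.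
  by apply: le_Rintegral => //; exact: bounded_integrable.
rewrite Rintegral_sum//; apply: ler_sum => k _; rewrite RintegralZl//; last first.
  by apply: bounded_integrable => //; exact: is_bounded_indic.
rewrite Rintegral_indic// ler_pM2l ?invr_gt0//.
by rewrite -lee_fin fineK ?mean_set_closed_le//; exact: outer_fin_num.
Qed.

(** The one-sided estimate also holds for 1 - f. *)
Lemma mean_integral01 (f : T -> R) : continuous f ->
  (forall x, 0 <= f x <= 1) ->
  I f = \int[mean_measure]_(x in (setT : set borelT)) f x.
Proof.
move=> cf f01; apply/eqP; rewrite eq_le mean_le_integral01//=.
have bf : is_bounded f by exact: continuous_is_bounded.
have mf : measurable_fun setT (f : borelT -> R) by exact: continuous_borel.
have cg : continuous (fun x => 1 - f x).
  by move=> x; apply: cvgB; [exact: cvg_cst|exact: cf].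
have := mean_le_integral01 cg; rewrite RintegralB//; last 2 first.
- by apply: bounded_integrable => //; exact: is_bounded_cst.
- exact: bounded_integrable.
rewrite Rintegral_cst1 => h.
have -> : \int[mean_measure]_(x in (setT : set borelT)) f x <= I f =
    (1 - I f <= 1 - \int[mean_measure]_(x in (setT : set borelT)) f x).
  by rewrite lerD2l lerN2.
have -> : 1 - I f = I (fun x => 1 - f x).
  have -> : (fun x => 1 - f x) = (fun x => 1 + (-1) * f x).
    by apply: funext => x; rewrite mulN1r.
  rewrite meanD ?mean_cst ?meanZ ?mulN1r//; first exact: is_bounded_cst.
  exact: is_boundedZ.
by apply: h => x; have := f01 x; lra.
Qed.

Lemma mean_integral (f : T -> R) : continuous f ->
  (\int[mean_measure]_(x in (setT : set borelT)) (f x)%:E = (I f)%:E)%E.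
Proof.
move=> cf.
have bf : is_bounded f by exact: continuous_is_bounded.
have mf : measurable_fun setT (f : borelT -> R) by exact: continuous_borel.
rewrite EFin_Rintegral//; congr EFin; have [B0 fB0] := bf.
pose B := `|B0| + 1; have B_gt0 : 0 < B by rewrite ltr_wpDl.
have fB x : `|f x| <= B.
  by rewrite (le_trans (fB0 x))// (le_trans (ler_norm _))// lerDl.
(* Rescale f to a function with values in [0, 1]. *)
pose g x := (B *+ 2)^-1 * (f x + B).
have B2 : 0 < B *+ 2 by rewrite mulrn_wgt0.
have g01 x : 0 <= g x <= 1.
  have := fB x; rewrite ler_norml => /andP[h1 h2].
  apply/andP; split; first by rewrite mulr_ge0 ?invr_ge0 ?(ltW B2)//; lra.
  by rewrite ler_pdivrMl// mulr1 mulr2n; lra.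
have cg : continuous g.
  move=> x; apply: cvgM; first exact: cvg_cst.
  by apply: cvgD; [exact: cf|exact: cvg_cst].
have bg : is_bounded g by exact: continuous_is_bounded.
have mg : measurable_fun setT (g : borelT -> R) by exact: continuous_borel.
have fE : f = (fun x => - B + (B *+ 2) * g x).
  by apply: funext => x; rewrite /g mulrA divff ?lt0r_neq0// mul1r addrC addrK.
have -> : I f = - B + (B *+ 2) * I g.
  by rewrite {1}fE (meanD (is_bounded_cst T (- B)) (is_boundedZ (B *+ 2) bg))
    mean_cst meanZ.
have ig : (mean_measure : measure borelT R).-integrable setT (EFin \o g).
  exact: bounded_integrable.
have ic : (mean_measure : measure borelT R).-integrable setT (EFin \o cst (- B)).
  by apply: bounded_integrable => //; exact: is_bounded_cst.
have iz : (mean_measure : measure borelT R).-integrable setT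
    (EFin \o (fun x => (B *+ 2) * g x)).
  apply: bounded_integrable => //; last exact: is_boundedZ.
  by apply: measurable_funM.
rewrite [in LHS]fE (RintegralD _ ic iz)// (RintegralZl _ _ ig)//.
by rewrite Rintegral_cst1 (mean_integral01 cg g01).
Qed.

(** The Riesz-Markov representation theorem, for functionals already defined
    on all bounded functions. *)
Lemma mean_representation :
  exists mu : probability borelT R,
    (forall Y : set borelT, measurable Y ->
      ereal_inf [set mu O | O in [set O : set T | open O /\ Y `<=` O]] = mu Y /\
      mu Y =
        ereal_sup [set mu C | C in [set C : set T | closed C /\ C `<=` Y]]) /\
    forall f : T -> R, continuous f -> (\int[mu]_x (f x)%:E = (I f)%:E)%E.
Proof.
exists mean_measure; split; first exact: mean_measure_regular.
exact: mean_integral.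
Qed.

End MeanRepresentation.

(** * Topology of the state space *)

(** If P fails on C, the sets A such that P holds on C minus A form a proper
    filter, and P cannot hold near a cluster point of it. *)
Lemma compact_induction (T : topologicalType) (C : set T) (P : set T -> Prop) :
  compact C -> P set0 -> (forall A B, P A -> P B -> P (A `|` B)) ->
  (forall A B, A `<=` B -> P B -> P A) ->
  (forall x, C x -> exists U, [/\ open U, U x & P U]) -> P C.
Proof.
move=> cC P0 PU Ple Ploc; apply: contrapT => nPC.
pose F : set_system T := [set A | P (C `\` A)].
have FF : ProperFilter F.
  split; first by rewrite /F/= setD0.
  split; rewrite /F /=.
  - by rewrite setDT.
  - by move=> A B PA PB; rewrite /= setDE setCI setIUr -!setDE; exact: PU.
  - by move=> A B AB; apply: Ple; exact: setDS.
have [|x [Cx Fx]] := cC F FF; first by rewrite /F/= setDv.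
have [U [oU Ux PUx]] := Ploc x Cx.
have [y [nUy Uy]] : (~` U `&` U) !=set0.
  apply: Fx; last exact: open_nbhs_nbhs.
  by rewrite /F/=; apply: Ple PUx; rewrite setDE setCK; exact: subIsetr.
exact: nUy.
Qed.

Section StateSpace.
Variables (R : realType) (E : pseudoEffectAlgebra) (s : states R E).
Notation K := (pointed_subset s).
Implicit Types (x y z : K) (a : E).

(** The topology of K is that of pointwise convergence. *)
Lemma states_cvg (F : set_system K) x : Filter F ->
  (forall a, hat a y @[y --> F] --> hat a x) -> F --> x.
Proof.
move=> FF Fx U [_ [[A oA <-] Ax AU]].
suff valF : (\val y : {ptws E -> R^o}) @[y --> F] -->
    (\val x : {ptws E -> R^o}).
  by apply: filterS AU _; apply: valF; exact: open_nbhs_nbhs.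
have FvF : Filter ((\val y : {ptws E -> R^o}) @[y --> F]) by exact: fmap_filter.
apply/cvg_sup => a W [_ [[D oD <-] Dx DW]].
change (F [set y | W (\val y)]).
suff FD : F [set y | D (hat a y)] by apply: filterS FD => y; exact: DW.
by apply: (Fx a); exact: open_nbhs_nbhs.
Qed.

Lemma hat_continuous a : continuous (hat a : K -> R).
Proof.
move=> x.
have val_x : (\val y : {ptws E -> R^o}) @[y --> x] --> (\val x : {ptws E -> R^o}).
  exact: (@initial_continuous _ _ (set_val : K -> {ptws E -> R^o})).
have proj_x := @proj_continuous {classic E} (fun=> R^o) a (\val x).
exact: (cvg_comp _ _ val_x proj_x).
Qed.

Lemma states_hausdorff : hausdorff_space K.
Proof.
move=> x y xy; apply: states_ext => a.
apply: (@norm_hausdorff R R^o) => A B xA yB.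
have [z [Az Bz]] := xy _ _ (hat_continuous xA) (hat_continuous yB).
by exists (hat a z).
Qed.

(** Along an ultrafilter the values at each a converge in [0, 1], and the
    limits form a state. *)
Lemma states_compact : compact [set: K].
Proof.
rewrite compact_ultra => F FU _.
have /choice[l lF] : forall a, exists l, hat a y @[y --> F] --> (l : R).
  move=> a; have := @segment_compact R 0 1; rewrite compact_ultra.
  move=> /(_ _ (ultrafilter_fmap (hat a) FU)) [|l [_ Gl]]; last by exists l.
  change (F [set y | hat a y \in `[0, 1]]); apply: filterE => y /=.
  rewrite in_itv/=.
  by case: (states_is_state y) => + _ _; exact.
have PF : ProperFilter F := ultra_proper.
have ls : is_state l.
  split=> [a|a b c abc|].
  - have y01 y : 0 <= hat a y <= 1 by case: (states_is_state y) => + _ _; exact.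
    apply/andP; split.
      by apply: cvgr_to_ge (lF a) _; apply: nearW => y; case/andP: (y01 y).
    by apply: cvgr_to_le (lF a) _; apply: nearW => y; case/andP: (y01 y).
  - have abE : hat c = (fun y : K => hat a y + hat b y).
      apply: funext => y; case: (states_is_state y) => _ + _; exact.
    have labc : hat c y @[y --> F] --> l a + l b.
      by rewrite abE; exact: cvgD (lF a) (lF b).
    exact: (cvg_unique (@norm_hausdorff R R^o) (lF c) labc).
  - have h1 : hat (pea_one E) = cst 1 :> (K -> R).
      by apply: funext => y; case: (states_is_state y).
    have := lF (pea_one E); rewrite h1 => h.
    exact: (cvg_unique (@norm_hausdorff R R^o) h (cvg_cst _)).
pose x : K := exist (fun m : {ptws E -> R^o} => m \in states R E) l
  (mem_set (A := states R E) ls).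
by exists x; split=> //; apply: states_cvg => a; exact: lF.
Qed.

(** The seminorms that define the topology of K. *)
Definition dist_on (L : seq E) x y := \sum_(a <- L) `|hat a x - hat a y|.

Lemma dist_on_ge0 L x y : 0 <= dist_on L x y.
Proof. by apply: sumr_ge0 => a _. Qed.

Lemma dist_on_refl L x : dist_on L x x = 0.
Proof. by apply: big1 => a _; rewrite subrr normr0. Qed.

Lemma dist_on_continuous L x : continuous (dist_on L x : K -> R).
Proof.
elim: L => [|a L IH].
  have -> : dist_on [::] x = cst 0 by apply: funext => y; rewrite /dist_on big_nil.
  exact: cst_continuous.
have -> : dist_on (a :: L) x = (fun y => `|hat a x - hat a y| + dist_on L x y).
  by apply: funext => y; rewrite /dist_on big_cons.
apply: continuous_funD => //; apply: continuous_fun_norm.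
by apply: continuous_funB; [exact: cst_continuous|exact: hat_continuous].
Qed.

(** The sets containing a ball of some [dist_on L] form a filter that
    converges to x pointwise, hence in K. *)
Lemma states_nbhs x (U : set K) : nbhs x U ->
  exists L d, 0 < d /\ forall y, dist_on L x y <= d -> U y.
Proof.
pose F : set_system K := [set U | exists L d, 0 < d /\
  forall y, dist_on L x y <= d -> U y].
move=> xU; suff : F U by [].
have FF : Filter F.
  split.
  - by exists [::], 1.
  - move=> A B [L1 [d1 [d10 h1]]] [L2 [d2 [d20 h2]]].
    exists (L1 ++ L2), (Num.min d1 d2); split=> [|y]; first by rewrite lt_min d10.
    rewrite /dist_on big_cat/= le_min => /andP[yd1 yd2].
    split; [apply: h1|apply: h2]; apply: le_trans; [|exact: yd1| |exact: yd2].
      by rewrite lerDl; exact: dist_on_ge0.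
    by rewrite lerDr; exact: dist_on_ge0.
  - by move=> A B AB [L [d [d0 h]]]; exists L, d; split=> // y /h/AB.
have : F --> x; last exact.
apply: states_cvg => a; apply/cvgrPdist_le => e e0.
by exists [:: a], e; split=> // y; rewrite /dist_on big_seq1.
Qed.

End StateSpace.

(** * Convex functions determine regular measures *)

Section ConvexFunctions.
Variables (R : realType) (E : pseudoEffectAlgebra) (s : states R E).
Notation K := (pointed_subset s).
Implicit Types (x y z : K) (a : E) (p q : K -> R).

Definition continuous_convex p := continuous p /\ convex_on p.

Lemma continuous_convex_cst (k : R) : continuous_convex (fun=> k).
Proof.
split=> [|x y z t _ _]; first exact: cst_continuous.
by rewrite -mulrDl addrC subrK mul1r.
Qed.

Lemma continuous_convexD p q : continuous_convex p -> continuous_convex q ->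
  continuous_convex (fun x => p x + q x).
Proof.
move=> [cp vp] [cq vq]; split=> [|x y z t t01 zE].
  exact: continuous_funD.
by have := vp x y z t t01 zE; have := vq x y z t t01 zE; lra.
Qed.

Lemma continuous_convexZ (k : R) p : 0 <= k -> continuous_convex p ->
  continuous_convex (fun x => k * p x).
Proof.
move=> k0 [cp vp]; split=> [|x y z t t01 zE].
  exact: continuous_funZ.
have := ler_wpM2l k0 (vp x y z t t01 zE); lra.
Qed.

Lemma continuous_convex_max p q : continuous_convex p -> continuous_convex q ->
  continuous_convex (fun x => Num.max (p x) (q x)).
Proof.
move=> [cp vp] [cq vq]; split=> [|x y z t t01 zE].
  exact: continuous_fun_max.
have /andP[t0 t1] := t01; have t1' : 0 <= 1 - t by rewrite subr_ge0.
have pm w : p w <= Num.max (p w) (q w) by rewrite le_max lexx.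
have qm w : q w <= Num.max (p w) (q w) by rewrite le_max lexx orbT.
rewrite ge_max (le_trans (vp _ _ _ _ t01 zE)) ?(le_trans (vq _ _ _ _ t01 zE))//;
  by rewrite lerD// ler_wpM2l.
Qed.

Lemma hat_combination a x y z (t : R) :
  \val z = (t *: \val x + (1 - t) *: \val y)%R ->
  hat a z = t * hat a x + (1 - t) * hat a y.
Proof. by move=> zE; rewrite /hat zE. Qed.

Lemma hat_affine a : affine_on (hat a : K -> R).
Proof. by move=> x y z t _; exact: hat_combination. Qed.

Lemma continuous_convex_dist_on L x : continuous_convex (dist_on L x).
Proof.
split; first exact: dist_on_continuous.
move=> y1 y2 z t /andP[t0]; rewrite -subr_ge0 => t1 zE.
rewrite /dist_on !mulr_sumr -big_split/=.
apply: ler_sum => a _; rewrite (hat_combination a zE).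
have -> : hat a x - (t * hat a y1 + (1 - t) * hat a y2) =
    t * (hat a x - hat a y1) + (1 - t) * (hat a x - hat a y2) by lra.
by rewrite (le_trans (ler_normD _ _))// !normrM (ger0_norm t0) (ger0_norm t1).
Qed.

(** A Urysohn function for A and the complement of O, which is a difference
    of continuous convex functions. *)
Definition dc_separated (O A : set K) := exists p q,
  [/\ continuous_convex p, continuous_convex q,
      forall x, 0 <= p x - q x <= 1,
      forall x, A x -> p x - q x = 1
    & forall x, ~ O x -> p x - q x = 0].

Lemma dc_separated0 (O : set K) : dc_separated O set0.
Proof.
exists (fun=> 0), (fun=> 0); split=> *; rewrite ?subrr ?lexx ?ler01//;
  exact: continuous_convex_cst.
Qed.

(** The maximum of two differences p - q and p' - q' is max (p + q', p' + q)
    - (q + q'). *)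
Lemma dc_separatedU (O A B : set K) :
  dc_separated O A -> dc_separated O B -> dc_separated O (A `|` B).
Proof.
move=> [p [q [cp cq pq01 pqA pqO]]] [p' [q' [cp' cq' pq01' pqB pqO']]].
exists (fun x => Num.max (p x + q' x) (p' x + q x)), (fun x => q x + q' x).
have dE x : Num.max (p x + q' x) (p' x + q x) - (q x + q' x) =
    Num.max (p x - q x) (p' x - q' x).
  by rewrite addr_maxl; congr Num.max; lra.
split.
- by apply: continuous_convex_max; exact: continuous_convexD.
- exact: continuous_convexD.
- move=> x; rewrite dE le_max ge_max; move: (pq01 x) (pq01' x).
  by move=> /andP[-> ->] /andP[_ ->].
- move=> x ABx; rewrite dE; move: (pq01 x) (pq01' x) => /andP[_ h] /andP[_ h'].
  by apply/eqP; rewrite eq_le ge_max h h' le_max; case: ABx => [/pqA|/pqB] ->;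
    rewrite lexx ?orbT.
- by move=> x Ox; rewrite dE pqO// pqO'// maxxx.
Qed.

Lemma dc_separated_nbhs (O : set K) x : open O -> O x ->
  exists U, [/\ open U, U x & dc_separated O U].
Proof.
move=> oO Ox; have [|L [d [d0 dO]]] := @states_nbhs _ _ s x O.
  exact: open_nbhs_nbhs.
exists [set y | dist_on L x y < d / 2]; split.
- exact: (open_comp (fun y _ => @dist_on_continuous _ _ s L x y) (@open_lt _ (d / 2))).
- by rewrite /= dist_on_refl divr_gt0.
(* max t 0 - max t (- 1) truncates - t to [0, 1]; it is 1 within d / 2 of x and
   0 beyond d. *)
pose t y := 2 / d * dist_on L x y + - 2.
have ct : continuous_convex t.
  apply: continuous_convexD; last exact: continuous_convex_cst.
  apply: continuous_convexZ; last exact: continuous_convex_dist_on.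
  by rewrite divr_ge0// ltW.
exists (fun y => Num.max (t y) 0), (fun y => Num.max (t y) (-1)); split.
- by apply: continuous_convex_max => //; exact: continuous_convex_cst.
- by apply: continuous_convex_max => //; exact: continuous_convex_cst.
- by move=> y; case: (leP (t y) 0) => ?; case: (leP (t y) (-1)) => ?; lra.
- move=> y /= yd; have ty : t y <= -1.
    by rewrite /t; have : 2 / d * dist_on L x y <= 1; last lra;
      rewrite mulrAC ler_pdivrMr// mul1r; lra.
  rewrite (max_r ty) max_r; lra.
- move=> y nOy; have dy : d < dist_on L x y.
    by rewrite ltNge; apply/negP => /dO.
  have ty : 0 <= t y.
    by rewrite /t; have : 2 <= 2 / d * dist_on L x y; last lra;
      rewrite mulrAC ler_pdivlMr//; lra.
  rewrite !max_l ?subrr//; lra.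
Qed.

Lemma dc_separated_closed (C O : set K) : closed C -> open O -> C `<=` O ->
  dc_separated O C.
Proof.
move=> cC oO CO; apply: compact_induction.
- exact: subclosed_compact cC (@states_compact _ _ s) _.
- exact: dc_separated0.
- exact: dc_separatedU.
- move=> A B AB [p [q [? ? ? pqB ?]]]; exists p, q; split=> // x /AB; exact: pqB.
- by move=> x /CO; exact: dc_separated_nbhs.
Qed.

End ConvexFunctions.

Arguments continuous_convex {R E} s p.
Arguments dc_separated {R E} s O A.

Section MeasuresOnStates.
Variables (R : realType) (E : pseudoEffectAlgebra) (s : states R E).
Notation K := (pointed_subset s).
Implicit Types (mu nu lambda : probability (borel s) R) (f : K -> R).

Lemma continuous_measurable f : continuous f ->
  measurable_fun setT (f : borel s -> R).
Proof. exact: continuous_borel. Qed.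

Lemma continuous_bounded f : continuous f -> is_bounded f.
Proof. exact: continuous_is_bounded (@states_compact _ _ s). Qed.

Lemma continuous_integrable mu f (D : set (borel s)) : measurable D ->
  continuous f -> mu.-integrable D (EFin \o (f : borel s -> R)).
Proof.
move=> mD cf; apply: bounded_integrable => //.
  exact: continuous_measurable.
exact: continuous_bounded.
Qed.

Lemma indic_integrable mu (A : set (borel s)) : measurable A ->
  mu.-integrable setT (EFin \o (\1_A : borel s -> R)).
Proof.
by move=> mA; apply: bounded_integrable => //; exact: is_bounded_indic.
Qed.

Lemma EFin_continuous_Rintegral mu f : continuous f ->
  (\int[mu]_x (f x)%:E = (\int[mu]_(x in setT) f x)%:E)%E.
Proof.
move=> cf; apply: EFin_Rintegral => //.
  exact: continuous_measurable.
exact: continuous_bounded.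
Qed.

(** A separating difference of convex functions has the same integral for
    both measures; it dominates the indicator of C and is dominated by that of
    U. *)
Lemma regular_closed_le mu lambda (C : set K) : regular_measure lambda ->
  (forall p, continuous_convex s p ->
    (\int[mu]_x (p x)%:E = \int[lambda]_x (p x)%:E)%E) ->
  closed C -> (mu C <= lambda C)%E.
Proof.
move=> rl mul cC; have mC : measurable (C : set (borel s)) by exact: borel_closed.
have [<- _] := rl _ mC; apply: le_ereal_inf_tmp => _ [U [oU CU] <-].
have [p [q [cp cq pq01 pqC pqU]]] := dc_separated_closed cC oU CU.
have mU : measurable (U : set (borel s)) by exact: borel_open.
have muE : \int[mu]_x (p x - q x) = \int[lambda]_x (p x - q x).
  rewrite !RintegralB//; try (by apply: continuous_integrable => //; case: cp);
    try by apply: continuous_integrable => //; case: cq.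
  by congr (fine _ - fine _); exact: mul.
have cpq : continuous (fun x => p x - q x).
  by apply: continuous_funB; [case: cp|case: cq].
have h1 : fine (mu C) <= \int[mu]_x (p x - q x).
  rewrite -Rintegral_indic//; apply: le_Rintegral => //.
  - exact: indic_integrable.
  - exact: continuous_integrable.
  - move=> x _; rewrite indicE; case: (boolP (x \in C)) => [/set_mem/pqC ->//|_].
    by case/andP: (pq01 x).
have h2 : \int[lambda]_x (p x - q x) <= fine (lambda U).
  rewrite -Rintegral_indic//; apply: le_Rintegral => //.
  - exact: continuous_integrable.
  - exact: indic_integrable.
  - move=> x _; rewrite indicE; case: (boolP (x \in U)) => [_|/negP nU].
      by case/andP: (pq01 x).
    by rewrite pqU// => Ux; apply: nU; exact/mem_set.
rewrite -(fineK (fin_num_measure mu _ mC)) -(fineK (fin_num_measure lambda _ mU)).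
by rewrite lee_fin (le_trans h1)// muE.
Qed.

Lemma regular_determined mu lambda : regular_measure mu ->
  regular_measure lambda ->
  (forall p, continuous_convex s p ->
    (\int[mu]_x (p x)%:E = \int[lambda]_x (p x)%:E)%E) ->
  same_measure mu lambda.
Proof.
move=> rm rl mul Y mY; have [_ ->] := rm _ mY; have [_ ->] := rl _ mY.
congr ereal_sup; apply: eq_imagel => C [cC _]; apply/eqP; rewrite eq_le.
by apply/andP; split; apply: regular_closed_le => // p /mul.
Qed.

End MeasuresOnStates.

(** * Discretizing a measure on the state space *)

Section Discretization.
Variables (R : realType) (E : pseudoEffectAlgebra) (s : states R E).
Notation K := (pointed_subset s).
Variable nu : probability (borel s) R.
Implicit Types (f : K -> R) (Y : set (borel s)).

Lemma partial_moment_positive_additive Y : measurable Y ->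
  positive_additive (fun a => \int[nu]_(x in Y) hat a x).
Proof.
move=> mY; split=> [a|a b c abc].
  apply: Rintegral_ge0 => x _; case: (states_is_state x) => x01 _ _.
  by case/andP: (x01 a).
rewrite -RintegralD//; [|apply: continuous_integrable => //; exact: hat_continuous..].
apply: eq_Rintegral => x _; case: (states_is_state x) => _ + _; exact.
Qed.

(** The mass of nu on Y times the barycenter of nu on Y. *)
Definition partial_moment Y (mY : measurable Y) :=
  Functional (partial_moment_positive_additive mY).

Lemma partial_moment_one Y (mY : measurable Y) :
  partial_moment mY (pea_one E) = fine (nu Y).
Proof.
rewrite /= -[RHS]mul1r -Rintegral_cst//; apply: eq_Rintegral => x _.
by case: (states_is_state x).
Qed.

(** Balls are convex, so the barycenter of a measure carried by a ball lies
    in it. *)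
Lemma dist_on_barycenter L (x : K) Y (mY : measurable Y) (d : R) :
  (forall y, Y y -> dist_on L x y <= d) -> fine (nu Y) != 0 ->
  dist_on L x (normalize s (partial_moment mY)) <= d.
Proof.
move=> Yd c0; set z := normalize _ _.
have cp : 0 < fine (nu Y) by rewrite lt_def c0 fine_ge0.
rewrite -(ler_pM2l cp) (@le_trans _ _ (\int[nu]_(y in Y) dist_on L x y))//; last first.
  rewrite mulrC -Rintegral_cst//; apply: le_Rintegral => //.
  - apply: continuous_integrable => //; exact: dist_on_continuous.
  - by apply: continuous_integrable => //; exact: cst_continuous.
elim: L {Yd} => [|a L IH].
  by rewrite {1}/dist_on big_nil mulr0; apply: Rintegral_ge0 => y _; exact: dist_on_ge0.
have dE y : dist_on (a :: L) x y = `|hat a x - hat a y| + dist_on L x y.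
  by rewrite /dist_on big_cons.
rewrite dE mulrDr.
have ca : continuous (fun y : K => hat a x - hat a y).
  by apply: continuous_funB; [exact: cst_continuous|exact: hat_continuous].
rewrite (@eq_Rintegral _ _ _ nu Y (fun y => `|hat a x - hat a y| + dist_on L x y));
  last by move=> y _; exact: dE.
rewrite RintegralD//; last 2 first.
- by apply: continuous_integrable => //; exact: continuous_fun_norm.
- by apply: continuous_integrable => //; exact: dist_on_continuous.
apply: lerD => //.
have -> : fine (nu Y) * `|hat a x - hat a z| = `|\int[nu]_(y in Y) (hat a x - hat a y)|.
  rewrite -{1}(gtr0_norm cp) -normrM; congr (`| _ |).
  rewrite RintegralB//; last 2 first.
  - by apply: continuous_integrable => //; exact: cst_continuous.
  - by apply: continuous_integrable => //; exact: hat_continuous.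
  rewrite Rintegral_cst// mulrBr mulrC; congr (_ - _).
  by rewrite -[RHS]/(partial_moment mY a) (hat_normalize s) partial_moment_one.
by apply: le_normr_Rintegral => //; exact: continuous_integrable.
Qed.

(** On a small ball f is nearly constant, and the barycenter stays in the
    ball. *)
Lemma local_jensen f (e : R) x : continuous f -> 0 < e ->
  exists U, [/\ open U, U x & forall Y (mY : measurable Y), Y `<=` U ->
    \int[nu]_(y in Y) f y <=
    homogenize s f (partial_moment mY) + e * fine (nu Y)].
Proof.
move=> cf e0; have e20 : 0 < e / 2 by rewrite divr_gt0.
have xf : nbhs x [set y | `|f x - f y| <= e / 2].
  by have := cf x; move=> /cvgrPdist_le /(_ _ e20).
have [L [d [d0 dL]]] := states_nbhs xf.
exists [set y | dist_on L x y < d]; split.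
- exact: (open_comp (fun y _ => @dist_on_continuous _ _ s L x y) (@open_lt _ d)).
- by rewrite /= dist_on_refl.
move=> Y mY YU; rewrite /homogenize partial_moment_one.
have YL y : Y y -> dist_on L x y <= d by move=> /YU /ltW.
apply: (@le_trans _ _ ((f x + e / 2) * fine (nu Y))).
  rewrite -Rintegral_cst//; apply: le_Rintegral => //.
  - exact: continuous_integrable.
  - by apply: continuous_integrable => //; exact: cst_continuous.
  - by move=> y /YL/dL /=; rewrite ler_norml => /andP[]; lra.
have [->|c0] := eqVneq (fine (nu Y)) 0; first by rewrite !mulr0 mul0r addr0.
have c_ge0 : 0 <= fine (nu Y) by exact: fine_ge0.
rewrite [in leRHS]mulrC -mulrDl ler_wpM2r//.
have := dL _ (dist_on_barycenter mY YL c0); rewrite /= ler_norml => /andP[]; lra.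
Qed.

(** The decomposition is built on Borel pieces of K. Cutting a piece of a
    union along its first member gives the union step, so by compactness the
    pieces can be taken inside the balls of [local_jensen]. *)
Lemma discretization f (e : R) : continuous f -> 0 < e ->
  (forall a, \int[nu]_x hat a x = hat a s) ->
  exists2 L, state_partition s L & \int[nu]_x f x <= partition_sum s f L + e.
Proof.
move=> cf e0 nus.
(* The larger Borel set A' makes the property inherited by arbitrary subsets. *)
pose P (A : set K) := exists A' : set (borel s), [/\ measurable A', A `<=` A' &
  forall Y (mY : measurable Y), Y `<=` A' ->
  exists2 L, \sum_(m <- L) m = partial_moment mY &
    \int[nu]_(y in Y) f y <= partition_sum s f L + e * fine (nu Y)].
suff [A' [mA' TA' /(_ setT measurableT)[] // L Ls Lf]] : P setT.
  exists L.
    rewrite /state_partition Ls; apply: functional_ext => a; exact: nus.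
  move: Lf; have -> : fine (nu setT) = 1 by rewrite probability_setT.
  by rewrite mulr1.
apply: compact_induction.
- exact: states_compact.
- exists set0; split=> // Y mY; rewrite subset0 => Y0; subst Y; exists [::].
    rewrite big_nil; apply: functional_ext => a /=.
    by rewrite Rintegral_set0.
  by rewrite Rintegral_set0 measure0 mulr0 addr0 /partition_sum big_nil.
- move=> A B [A' [mA' AA' PA]] [B' [mB' BB' PB]].
  exists (A' `|` B'); split; [exact: measurableU|exact: setUSS|].
  move=> Y mY YAB.
  have mYA : measurable (Y `&` A') by exact: measurableI.
  have mYB : measurable (Y `\` A') by exact: measurableD.
  have [L1 L1m L1f] := PA _ mYA (@subIsetr _ _ _).
  have [|L2 L2m L2f] := PB _ mYB.
    by move=> y [/YAB[]].
  have dY : [disjoint Y `&` A' & Y `\` A'].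
    by apply/eqP; rewrite -subset0 => y [[_ ?] []].
  have YE : Y = (Y `&` A') `|` (Y `\` A') by rewrite setUIDK.
  have YI g : continuous g -> \int[nu]_(y in Y) g y =
      \int[nu]_(y in Y `&` A') g y + \int[nu]_(y in Y `\` A') g y.
    move=> cg; rewrite -Rintegral_setU// -?YE//.
    exact: continuous_integrable.
  exists (L1 ++ L2).
    rewrite big_cat/= L1m L2m; apply: functional_ext => a.
    by rewrite functional_addE /= YI//; exact: hat_continuous.
  rewrite YI// /partition_sum big_cat/=.
  have -> : fine (nu Y) = fine (nu (Y `&` A')) + fine (nu (Y `\` A')).
    by rewrite -!partial_moment_one /= YI//; exact: hat_continuous.
  by rewrite mulrDr addrACA lerD.
- by move=> A B AB [A' [mA' BA' PA]]; exists A'; split=> //; exact: subset_trans BA'.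
- move=> x _; have [U [oU Ux hU]] := local_jensen x cf e0.
  exists U; split=> //; exists U; split=> //; first exact: borel_open.
  move=> Y mY YU; exists [:: partial_moment mY]; first by rewrite big_seq1.
  by rewrite /partition_sum big_seq1; exact: hU.
Qed.

End Discretization.

(** * The greatest measure representing a state *)

Section GreatestMeasure.
Variables (R : realType) (E : pseudoEffectAlgebra) (s : states R E).
Notation K := (pointed_subset s).
Implicit Types (mu nu lambda : probability (borel s) R) (f : K -> R).

Lemma affine_convex f : affine_on f -> convex_on f.
Proof. by move=> af x y z t t01 zE; rewrite (af x y z t t01 zE). Qed.

Lemma affine_convexN f : affine_on f -> convex_on (fun x => - f x).
Proof. by move=> af x y z t t01 zE; rewrite (af x y z t t01 zE); lra. Qed.

Lemma continuous_funN f : continuous f -> continuous (fun x => - f x).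
Proof.
move=> cf; have -> : (fun x => - f x) = (fun x => (-1) * f x).
  by apply: funext => x; rewrite mulN1r.
exact: continuous_funZ.
Qed.

Lemma RintegralN mu f : continuous f ->
  \int[mu]_x (- f x) = - \int[mu]_x f x.
Proof.
move=> cf; rewrite -[RHS]mulN1r -RintegralZl//; last exact: continuous_integrable.
by apply: eq_Rintegral => x _; rewrite mulN1r.
Qed.

Lemma choquet_leP mu nu f : choquet_le mu nu -> continuous f -> convex_on f ->
  \int[mu]_x f x <= \int[nu]_x f x.
Proof.
by move=> mn cf vf; have := mn f cf vf; rewrite !EFin_continuous_Rintegral// lee_fin.
Qed.

(** An affine function and its opposite are both convex. *)
Lemma choquet_le_affine mu nu f : choquet_le mu nu -> continuous f ->
  affine_on f -> \int[nu]_x f x = \int[mu]_x f x.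
Proof.
move=> mn cf af; apply/eqP; rewrite eq_le; apply/andP; split; last first.
  by apply: choquet_leP => //; exact: affine_convex.
have := choquet_leP mn (continuous_funN cf) (affine_convexN af).
by rewrite !RintegralN// lerN2.
Qed.

(** For f convex, the mean of f dominates f s and, by discretization, the
    integral of f against every probability with barycenter s. For f affine the
    first bound applies to f and to its opposite. *)
Lemma exists_greatest_measure : RDP1 E -> exists mu,
  [/\ regular_measure mu,
      forall f, continuous f -> affine_on f -> \int[mu]_x f x = f s
    & forall nu, (forall a, \int[nu]_x hat a x = hat a s) -> choquet_le nu mu].
Proof.
move=> hE; have [I [meanI Iconv]] := exists_mean s hE.
have [mu [regmu muI]] :=
  mean_representation (@states_hausdorff _ _ s) (@states_compact _ _ s) meanI.
have muE f : continuous f -> \int[mu]_x f x = I f.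
  by move=> cf; rewrite /Rintegral muI.
have s1 f : partition_sum s f [:: state_functional s] = f s.
  by rewrite /partition_sum big_seq1 homogenize_state.
have ps : state_partition s [:: state_functional s].
  by rewrite /state_partition big_seq1.
have s_le f : continuous f -> convex_on f -> f s <= \int[mu]_x f x.
  move=> cf vf; rewrite muE// -{1}s1; apply: Iconv => //.
  exact: (@continuous_bounded _ _ s).
exists mu; split=> [//|f cf af|nu nus f cf vf].
  apply/eqP; rewrite eq_le s_le//; last exact: affine_convex.
  rewrite andbT -lerN2 -RintegralN//; apply: s_le; last exact: affine_convexN.
  exact: continuous_funN.
rewrite !EFin_continuous_Rintegral// lee_fin; apply/ler_addgt0Pr => e e0.
have [L Ls Lf] := discretization cf e0 nus.
rewrite (le_trans Lf)// lerD2r muE//; apply: Iconv => //.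
exact: (@continuous_bounded _ _ s).
Qed.

End GreatestMeasure.

Local Open Scope ereal_scope.

Theorem theorem5p4 (R : realType) (E : pseudoEffectAlgebra) (hE : RDP1 E)
    (s : states R E) :
  let represents (mu : probability (borel s) R) :=
    [/\ maximal_measure mu,
        measure_equiv mu (\d_(s : borel s))
      & forall a : E, (hat a s)%:E = \int[mu]_x (hat a x)%:E] in
  exists mu : probability (borel s) R,
    represents mu /\
    forall nu : probability (borel s) R, represents nu -> same_measure nu mu.

Proof.
move=> represents.
have [mu [regmu affmu greatest]] := exists_greatest_measure s hE.
have hat_mu a : (\int[mu]_x hat a x = hat a s)%R.
  by apply: affmu; [exact: hat_continuous|exact: hat_affine].
(* A measure above mu has the same integrals of the affine functions hat a. *)
have mu_max : maximal_measure mu.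
  split=> // lambda reglambda mu_lambda.
  have lambda_mu : choquet_le lambda mu.
    apply: greatest => a; rewrite -hat_mu.
    by apply: choquet_le_affine => //; [exact: hat_continuous|exact: hat_affine].
  apply: regular_determined => // p [cp vp].
  by apply/eqP; rewrite eq_le lambda_mu// mu_lambda.
exists mu; split.
  split=> // [f cf af|a].
    rewrite EFin_continuous_Rintegral// affmu// integral_dirac//.
      by rewrite diracT mul1e.
    by apply/measurable_EFinP; exact: continuous_measurable.
  by rewrite EFin_continuous_Rintegral ?hat_mu//; exact: hat_continuous.
move=> nu [[_ nu_max] _ hat_nu] Y mY; apply/esym.
apply: nu_max => //; apply: greatest => a.
by rewrite /Rintegral -hat_nu.
Qed.
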